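(* Let $G=\{f_1,\dots,f_r\}\subset F_0=R^s$ be a Gröbner basis with respect to $>$ consisting of non-zero vectors, let $\succ$ be the monomial ordering on $F_1=R^r$ induced by $>$ and $G$, and let $\sigma\in \mathrm{L}_\succ(\mathrm{Syz}(G))\subset F_1$ be a (non-zero) leading syzygy term. Consider the following procedure LiftTree$(\sigma)$, which uses the recursive procedure LiftSubtree described in the context. 1. Set $g:=\psi(\sigma)$, let $T$ be the set of terms of $g-\mathrm{LOT}(g\mid G)$, and set $\bar\sigma:=\sigma$. 2. For each $t\in T$: choose any term $m\,\mathrm{e}_i\in F_1$ (with $m$ a term of $R$) such that $m\,\mathrm{LT}(f_i)=t$ and $\sigma\succ m\,\mathrm{e}_i$, and replace $\bar\sigma$ by $\bar\sigma-\mathrm{LiftSubtree}(m\,\mathrm{e}_i)$. 3. Return $\bar\sigma$. Then the required choices are always possible, the procedure terminates for all such choices (including those made inside LiftSubtree), and the returned element $\bar\sigma$ is a lifting of $\sigma$ with respect to $G$ and $\succ$, that is, $\mathrm{LT}_\succ(\bar\sigma)=\sigma$ and $\bar\sigma\in\mathrm{Syz}(G)$.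
   Context: $K$ is a field and $R=K[x_1,\dots,x_n]$. For a free module $F=R^k$ with canonical basis $\mathrm{e}_1,\dots,\mathrm{e}_k$, a monomial of $F$ is a product $m\,\mathrm{e}_i$ with $m$ a monomial of $R$, and a term is a monomial times a scalar in $K$ (non-zero unless stated otherwise). The monomial $m_1\mathrm{e}_i$ divides $m_2\mathrm{e}_j$ if $i=j$ and $m_1$ divides $m_2$; divisibility of terms ignores non-zero coefficients. A monomial ordering on $F$ is a total ordering $>$ on the monomials of $F$ such that $m_1\mathrm{e}_i>m_2\mathrm{e}_j$ implies $mm_1\mathrm{e}_i>mm_2\mathrm{e}_j$ for every monomial $m$ of $R$, and such that $m_1\mathrm{e}_i>m_2\mathrm{e}_i\iff m_1\mathrm{e}_j>m_2\mathrm{e}_j$ for all $i,j$. It thus determines a unique compatible monomial ordering on $R$; all orderings are assumed global, i.e. this ordering on $R$ is global ($1$ is the smallest monomial). Terms are compared via their underlying monomials. $\mathrm{LM}$, $\mathrm{LT}$ denote leading monomial and leading term (including coefficient). $>$ is a monomial ordering on $F_0=R^s$. $G$ is a Gröbner basis means that it is a Gröbner basis of the submodule $\langle G\rangle_R\subset F_0$ it generates. The map $\psi:F_1=R^r\to F_0$ is the $R$-linear map with $\psi(\mathrm{e}_i)=f_i$, and $\mathrm{Syz}(G)=\ker\psi$. The ordering $\succ$ on $F_1$ induced by $>$ and $G$ is given by $m_1\mathrm{e}_i\succ m_2\mathrm{e}_j$ if and only if $\mathrm{LM}(m_1f_i)>\mathrm{LM}(m_2f_j)$, or $\mathrm{LM}(m_1f_i)=\mathrm{LM}(m_2f_j)$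 and $i>j$. $\mathrm{L}_\succ(\mathrm{Syz}(G))$ is the submodule of $F_1$ generated by the leading monomials with respect to $\succ$ of the non-zero elements of $\mathrm{Syz}(G)$; a leading syzygy term is a term of $F_1$ lying in it. A term $t\in F_0$ is a lower order term with respect to $G$ if $\mathrm{LM}(f)\nmid t$ for all $f\in G$. For $g\in F_0$, $\mathrm{LOT}(g\mid G)$ is the sum of those terms occurring in $g$ that are of lower order with respect to $G$. The recursive procedure LiftSubtree$(\tau)$, for a non-zero term $\tau\in F_1$: set $g:=\psi(\tau)-\mathrm{LT}(\psi(\tau))$, let $T$ be the set of terms of $g-\mathrm{LOT}(g\mid G)$, and set $\hat\tau:=\tau$; for each $t\in T$ choose any term $m\,\mathrm{e}_i\in F_1$ with $m\,\mathrm{LT}(f_i)=t$ and replace $\hat\tau$ by $\hat\tau-\mathrm{LiftSubtree}(m\,\mathrm{e}_i)$; return $\hat\tau$. *)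

(* Defs.v *)
From Stdlib Require Export Relations.Relation_Operators.
From mathcomp Require Export all_boot all_order all_algebra.
From mathcomp Require Export mpoly.

Set Implicit Arguments.
Unset Strict Implicit.
Unset Printing Implicit Defensive.

Import GRing.Theory.

Local Open Scope ring_scope.

(* The free module R^k over R = K[x_1, ..., x_n] is 'rV[{mpoly K[n]}]_k.      *)

(* The pair (m, i) stands for the monomial m e_i of R^k.                      *)
Notation fmon n k := ('X_{1..n} * 'I_k)%type (only parsing).

(* The pair (c, (m, i)) stands for the term c m e_i.  The type does not force *)
(* c != 0, but all terms produced below have a non-zero coefficient.          *)
Notation fterm K n k := (K * ('X_{1..n} * 'I_k))%type (only parsing).

(* (c, (m, i)) |-> c m e_i *)
Definition fterm_val (K : fieldType) (n k : nat) (t : fterm K n k) :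
    'rV[{mpoly K[n]}]_k :=
  (t.1 *: 'X_[t.2.1]) *: delta_mx 0 t.2.2.

Definition fmon_dvd (n k : nat) (a b : fmon n k) : bool :=
  (a.2 == b.2) && (a.1 <= b.1)%MM.

Definition fsupp (K : fieldType) (n k : nat) (v : 'rV[{mpoly K[n]}]_k) :
    seq (fmon n k) :=
  [seq (m, i) | i <- enum 'I_k, m <- msupp (v 0 i)].

Definition fterms (K : fieldType) (n k : nat) (v : 'rV[{mpoly K[n]}]_k) :
    seq (fterm K n k) :=
  [seq ((v 0 a.2)@_(a.1), a) | a <- fsupp v].

(* Monomial orderings are given by the strict relation gt a b, read a > b.    *)
Record monomial_ordering (n k : nat) (gt : rel (fmon n k)) : Prop :=
  MonomialOrdering {
    mo_irr : irreflexive gt;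
    mo_trans : transitive gt;
    mo_total : forall a b : fmon n k, a != b -> gt a b || gt b a;
    mo_mul : forall (m m1 m2 : 'X_{1..n}) (i j : 'I_k),
      gt (m1, i) (m2, j) -> gt ((m + m1)%MM, i) ((m + m2)%MM, j);
    mo_compat : forall (m1 m2 : 'X_{1..n}) (i j : 'I_k),
      gt (m1, i) (m2, i) = gt (m1, j) (m2, j)
  }.

(* 1 is the smallest monomial for the ordering on R compatible with gt, which *)
(* compares m1 and m2 as gt compares m1 e_i and m2 e_i (for any i).           *)
Definition global_ordering (n k : nat) (gt : rel (fmon n k)) : Prop :=
  forall (m : 'X_{1..n}) (i : 'I_k), m != 0%MM -> gt (m, i) (0%MM, i).

(* The gt-largest monomial of v; None exactly when v = 0.                     *)
Definition LM (K : fieldType) (n k : nat) (gt : rel (fmon n k))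
    (v : 'rV[{mpoly K[n]}]_k) : option (fmon n k) :=
  ohead [seq a <- fsupp v | all (fun b => (b == a) || gt a b) (fsupp v)].

Definition LT (K : fieldType) (n k : nat) (gt : rel (fmon n k))
    (v : 'rV[{mpoly K[n]}]_k) : option (fterm K n k) :=
  omap (fun a : fmon n k => ((v 0 a.2)@_(a.1), a)) (LM gt v).

(* The leading term as an element of R^k, with value 0 at v = 0.              *)
Definition LTval (K : fieldType) (n k : nat) (gt : rel (fmon n k))
    (v : 'rV[{mpoly K[n]}]_k) : 'rV[{mpoly K[n]}]_k :=
  oapp (@fterm_val K n k) 0 (LT gt v).

Definition submodule_gen (K : fieldType) (n k : nat)
    (S : 'rV[{mpoly K[n]}]_k -> Prop) (v : 'rV[{mpoly K[n]}]_k) : Prop :=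
  exists (N : nat) (a : 'I_N -> {mpoly K[n]}) (w : 'I_N -> 'rV[{mpoly K[n]}]_k),
    (forall j, S (w j)) /\ v = \sum_j a j *: w j.

(* L_gt(S): the submodule generated by the leading monomials of the non-zero  *)
(* elements of S.                                                             *)
Definition leading_module (K : fieldType) (n k : nat) (gt : rel (fmon n k))
    (S : 'rV[{mpoly K[n]}]_k -> Prop) : 'rV[{mpoly K[n]}]_k -> Prop :=
  submodule_gen (fun w => exists (v : 'rV[{mpoly K[n]}]_k) (a : fmon n k),
    [/\ S v, v != 0, LM gt v = Some a & w = fterm_val (1, a)]).

(* The finite set G = {f_1, ..., f_r} is given by the family f.               *)
Definition family_set (K : fieldType) (n s r : nat)
    (f : 'I_r -> 'rV[{mpoly K[n]}]_s) (v : 'rV[{mpoly K[n]}]_s) : Prop :=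
  exists i, v = f i.

(* L(G) = L(<G>) *)
Definition groebner_basis (K : fieldType) (n s r : nat) (gt : rel (fmon n s))
    (f : 'I_r -> 'rV[{mpoly K[n]}]_s) : Prop :=
  forall v, leading_module gt (family_set f) v <->
            leading_module gt (submodule_gen (family_set f)) v.

Definition psi (K : fieldType) (n s r : nat)
    (f : 'I_r -> 'rV[{mpoly K[n]}]_s) (v : 'rV[{mpoly K[n]}]_r) :
    'rV[{mpoly K[n]}]_s :=
  \sum_i v 0 i *: f i.

Definition Syz (K : fieldType) (n s r : nat)
    (f : 'I_r -> 'rV[{mpoly K[n]}]_s) (v : 'rV[{mpoly K[n]}]_r) : Prop :=
  psi f v = 0.

(* The None branch is only reached if some f i is 0.                          *)
Definition induced_ordering (K : fieldType) (n s r : nat)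
    (gt : rel (fmon n s)) (f : 'I_r -> 'rV[{mpoly K[n]}]_s) :
    rel (fmon n r) :=
  fun a b =>
    match LM gt ('X_[a.1] *: f a.2), LM gt ('X_[b.1] *: f b.2) with
    | Some u, Some v => gt u v || (u == v) && (b.2 < a.2)%N
    | _, _ => false
    end.

Definition lower_order (K : fieldType) (n s r : nat) (gt : rel (fmon n s))
    (f : 'I_r -> 'rV[{mpoly K[n]}]_s) (t : fterm K n s) : bool :=
  [forall i, if LM gt (f i) is Some a then ~~ fmon_dvd a t.2 else true].

Definition LOT (K : fieldType) (n s r : nat) (gt : rel (fmon n s))
    (f : 'I_r -> 'rV[{mpoly K[n]}]_s) (g : 'rV[{mpoly K[n]}]_s) :
    'rV[{mpoly K[n]}]_s :=
  \sum_(t <- fterms g | lower_order gt f t) fterm_val t.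

Definition tree_terms (K : fieldType) (n s r : nat) (gt : rel (fmon n s))
    (f : 'I_r -> 'rV[{mpoly K[n]}]_s) (sigma : fterm K n r) :
    seq (fterm K n s) :=
  let g := psi f (fterm_val sigma) in fterms (g - LOT gt f g).

Definition subtree_terms (K : fieldType) (n s r : nat) (gt : rel (fmon n s))
    (f : 'I_r -> 'rV[{mpoly K[n]}]_s) (tau : fterm K n r) :
    seq (fterm K n s) :=
  let h := psi f (fterm_val tau) in
  let g := h - LTval gt h in fterms (g - LOT gt f g).

(* u = m e_i (m a term of R) is an admissible choice for t: m LT(f_i) = t.    *)
Definition subtree_choice (K : fieldType) (n s r : nat) (gt : rel (fmon n s))
    (f : 'I_r -> 'rV[{mpoly K[n]}]_s) (t : fterm K n s) (u : fterm K n r) :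
    Prop :=
  (u.1 *: 'X_[u.2.1]) *: LTval gt (f u.2.2) = fterm_val t.

Definition tree_choice (K : fieldType) (n s r : nat) (gt : rel (fmon n s))
    (f : 'I_r -> 'rV[{mpoly K[n]}]_s) (sigma : fterm K n r)
    (t : fterm K n s) (u : fterm K n r) : Prop :=
  subtree_choice gt f t u /\ induced_ordering gt f sigma.2 u.2.

(* LiftSubtree and LiftTree are non-deterministic: they are the relations     *)
(* between an input and the values returned by the finite runs on it, with    *)
(* ch t the choice made for t and res t the value of the recursive call on    *)
(* ch t.  Different calls may make different choices for the same t.          *)
Inductive LiftSubtree (K : fieldType) (n s r : nat) (gt : rel (fmon n s))
    (f : 'I_r -> 'rV[{mpoly K[n]}]_s) :
    fterm K n r -> 'rV[{mpoly K[n]}]_r -> Prop :=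
| LiftSubtree_run (tau : fterm K n r)
    (ch : fterm K n s -> fterm K n r)
    (res : fterm K n s -> 'rV[{mpoly K[n]}]_r) :
    (forall t, t \in subtree_terms gt f tau -> subtree_choice gt f t (ch t)) ->
    (forall t, t \in subtree_terms gt f tau ->
       LiftSubtree gt f (ch t) (res t)) ->
    LiftSubtree gt f tau
      (fterm_val tau - \sum_(t <- subtree_terms gt f tau) res t).

Inductive LiftTree (K : fieldType) (n s r : nat) (gt : rel (fmon n s))
    (f : 'I_r -> 'rV[{mpoly K[n]}]_s) (sigma : fterm K n r) :
    'rV[{mpoly K[n]}]_r -> Prop :=
| LiftTree_run
    (ch : fterm K n s -> fterm K n r)
    (res : fterm K n s -> 'rV[{mpoly K[n]}]_r) :
    (forall t, t \in tree_terms gt f sigma ->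
       tree_choice gt f sigma t (ch t)) ->
    (forall t, t \in tree_terms gt f sigma ->
       LiftSubtree gt f (ch t) (res t)) ->
    LiftTree gt f sigma
      (fterm_val sigma - \sum_(t <- tree_terms gt f sigma) res t).

(* For some choice, LiftTree(sigma), resp. LiftSubtree(tau), directly calls   *)
(* LiftSubtree(u).                                                            *)
Definition tree_call (K : fieldType) (n s r : nat) (gt : rel (fmon n s))
    (f : 'I_r -> 'rV[{mpoly K[n]}]_s) (sigma u : fterm K n r) : Prop :=
  exists2 t, t \in tree_terms gt f sigma & tree_choice gt f sigma t u.

Definition subtree_call (K : fieldType) (n s r : nat) (gt : rel (fmon n s))
    (f : 'I_r -> 'rV[{mpoly K[n]}]_s) (tau u : fterm K n r) : Prop :=
  exists2 t, t \in subtree_terms gt f tau & subtree_choice gt f t u.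

(* Some run of LiftTree(sigma) calls LiftSubtree(tau), at any depth.          *)
Definition reachable_call (K : fieldType) (n s r : nat) (gt : rel (fmon n s))
    (f : 'I_r -> 'rV[{mpoly K[n]}]_s) (sigma tau : fterm K n r) : Prop :=
  exists2 u, tree_call gt f sigma u &
    clos_refl_trans (fterm K n r) (subtree_call gt f) u tau.

Definition choices_possible (K : fieldType) (n s r : nat)
    (gt : rel (fmon n s)) (f : 'I_r -> 'rV[{mpoly K[n]}]_s)
    (sigma : fterm K n r) : Prop :=
  (forall t, t \in tree_terms gt f sigma ->
     exists u, tree_choice gt f sigma t u) /\
  (forall tau, reachable_call gt f sigma tau ->
     forall t, t \in subtree_terms gt f tau ->
       exists u, subtree_choice gt f t u).

(* Each call performs finitely many calls, one for each of its terms, so that *)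
(* all runs are finite when, whatever the choices, the recursion is           *)
(* well-founded below each call.                                              *)
Definition terminates (K : fieldType) (n s r : nat)
    (gt : rel (fmon n s)) (f : 'I_r -> 'rV[{mpoly K[n]}]_s)
    (sigma : fterm K n r) : Prop :=
  forall u, tree_call gt f sigma u ->
    Acc (fun callee caller => subtree_call gt f caller callee) u.

Definition lifting (K : fieldType) (n s r : nat)
    (gt : rel (fmon n s)) (f : 'I_r -> 'rV[{mpoly K[n]}]_s)
    (sigma : fterm K n r) (v : 'rV[{mpoly K[n]}]_r) : Prop :=
  LT (induced_ordering gt f) v = Some sigma /\ Syz f v.

(* Under these two conditions LiftTree(sigma) does return a value.            *)
Lemma LiftTree_returns (K : fieldType) (n s r : nat) (gt : rel (fmon n s))
    (f : 'I_r -> 'rV[{mpoly K[n]}]_s) (sigma : fterm K n r) :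
  choices_possible gt f sigma -> terminates gt f sigma ->
  exists v, LiftTree gt f sigma v.
Proof.
have fin_choice (A : eqType) (B : Type) (b0 : B) (l : seq A) (P : A -> B -> Prop) :
    (forall t, t \in l -> exists u, P t u) ->
    exists g : A -> B, forall t, t \in l -> P t (g t).
  elim: l => [|a l IHl] Pl; first by exists (fun=> b0).
  have [u Pu] := Pl a (mem_head a l).
  have [t tl|g Pg] := IHl; first by apply: Pl; rewrite in_cons tl orbT.
  exists (fun t => if t == a then u else g t) => t; rewrite in_cons.
  by have [->|_ /Pg] := eqVneq t a.
move=> [tree_ch sub_ch] term.
have sub_ret u : tree_call gt f sigma u -> exists v, LiftSubtree gt f u v.
  move=> call_u; have reach_u : reachable_call gt f sigma u.
    by exists u => //; apply: rt_refl.
  elim: {call_u}(term u call_u) reach_u => tau _ IH reach_tau.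
  have [|ch Pch] := @fin_choice _ _ tau (subtree_terms gt f tau)
    (subtree_choice gt f); first exact: sub_ch.
  have [t t_in|res Pres] := @fin_choice _ _ 0 (subtree_terms gt f tau)
    (fun t v => LiftSubtree gt f (ch t) v).
    have call_t : subtree_call gt f tau (ch t) by exists t => //; apply: Pch.
    apply: (IH _ call_t); have [u0 call_u0 path_u0] := reach_tau.
    by exists u0 => //; apply: rt_trans path_u0 _; apply: rt_step.
  by exists (fterm_val tau - \sum_(t <- subtree_terms gt f tau) res t);
     apply: (LiftSubtree_run Pch Pres).
have [|ch Pch] := @fin_choice _ _ sigma (tree_terms gt f sigma)
  (tree_choice gt f sigma); first exact: tree_ch.
have [t t_in|res Pres] := @fin_choice _ _ 0 (tree_terms gt f sigma)
  (fun t v => LiftSubtree gt f (ch t) v).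
  by apply: sub_ret; exists t => //; apply: Pch.
by exists (fterm_val sigma - \sum_(t <- tree_terms gt f sigma) res t);
   apply: (LiftTree_run Pch Pres).
Qed.

(* Main.v *)
(* A call LiftSubtree(u) made for the term t satisfies LT(psi(u)) = t, so the *)
(* leading monomials of the psi(u) strictly decrease along the recursion; it  *)
(* terminates because a global ordering is well-founded, by Dickson's lemma.  *)
(* By induction on a run, psi of the value returned by LiftSubtree(tau) is    *)
(* LT(psi(tau)) up to lower order terms, hence psi of the value returned by   *)
(* LiftTree(sigma) has only lower order terms.  It lies in the module         *)
(* generated by the Groebner basis, so it is 0.  All other monomials of the   *)
(* returned value are smaller than sigma.  The only delicate choice is the    *)
(* one for LT(psi(sigma)): a syzygy with leading monomial dividing sigma      *)
(* contains another monomial with the same image and a smaller index.         *)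

From HB Require Import structures.
From Stdlib Require Import Classical ClassicalEpsilon.
Require Import Defs.

Set Implicit Arguments.
Unset Strict Implicit.
Unset Printing Implicit Defensive.

Import GRing.Theory.

Local Open Scope ring_scope.

(** * Dickson's lemma *)

(** The whole argument follows the leading monomial of [psi] of the current term. A call made for
    [t] has image with leading term [t] ([subtree_choiceP]), and inside [LiftSubtree] that [t] lies
    strictly below the leading monomial of the caller's image ([subtree_termsP]). This gives
    termination ([subtree_call_Acc]) and keeps every new monomial below the caller's
    ([LiftSubtree_support], [LiftTree_LT]). On monomials divisible by some LM(f_i) the images
    telescope to zero ([LiftSubtree_psi], [LiftTree_psi]), whereas a non-zero element of the module
    generated by a Groebner basis has such a leading monomial ([groebner_lead_divisible]); so the
    result is a syzygy. That sigma is a leading syzygy term is what makes the choice for its own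
    leading image possible ([leading_term_cancel], [tree_choice_exists]). *)

Lemma nondecreasing_subsequence (g : nat -> nat) :
  exists phi : nat -> nat, {homo phi : i j / (i < j)%N} /\
    {homo g \o phi : i j / (i <= j)%N}.
Proof.
have min_tail N : {k | (N <= k)%N /\ forall j, (N <= j)%N -> (g k <= g j)%N}.
  apply: constructive_indefinite_description; apply: NNPP => no_min.
  have no_tail v k : (N <= k)%N -> g k <> v.
    elim/ltn_ind: v k => v IHv k le_Nk gk_v; apply: no_min; exists k; split=> // j le_Nj.
    by rewrite gk_v leqNgt; apply/negP => /IHv/(_ j le_Nj).
  exact: (no_tail (g N) N).
(* Each index minimises [g] over the tail starting just after the previous index, so the values
   along [phi] cannot decrease. *)
pose phi i := iter i (fun k => sval (min_tail k.+1)) (sval (min_tail 0%N)).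
have phiS i : (phi i < phi i.+1)%N by rewrite /= ; case: (min_tail _) => k [].
exists phi; split; first exact: homo_ltn ltn_trans phiS.
apply: homo_leq leq_trans _ => // i.
have min_i j : (phi i <= j)%N -> (g (phi i) <= g j)%N.
  case: i => [|i] /= le_ij; case: (min_tail _) le_ij => k [le_k min_k] /= le_kj.
    exact: min_k.
  by apply: min_k; apply: leq_trans le_kj.
exact/min_i/ltnW.
Qed.

(** Monotonicity survives passing to a subsequence, so the sequence can be thinned out once for each
    element of [l]. *)
Lemma common_nondecreasing_subsequence (I : eqType) (g : nat -> I -> nat)
    (l : seq I) :
  exists phi : nat -> nat, {homo phi : i j / (i < j)%N} /\
    {in l, forall x, {homo (fun i => g (phi i) x) : i j / (i <= j)%N}}.
Proof.
elim: l => [|x l [phi [phi_lt phi_g]]]; first by exists id; split.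
have [chi [chi_lt chi_g]] := nondecreasing_subsequence (fun i => g (phi i) x).
exists (phi \o chi); split=> [i j lt_ij|y]; first exact/phi_lt/chi_lt.
rewrite in_cons => /predU1P[->|y_l] i j le_ij; first exact: chi_g.
exact/(phi_g y y_l)/(ltnW_homo chi_lt).
Qed.

(* Equality of the components of two monomials m e_i is encoded as two        *)
(* inequalities, between the indices i and between their opposites.           *)
Lemma dickson (n k : nat) (u : nat -> fmon n k) :
  exists i j, (i < j)%N /\ fmon_dvd (u i) (u j).
Proof.
pose g i (x : 'I_n + bool) : nat := match x with
  | inl l => (u i).1 l
  | inr b => if b then val (u i).2 else (k - (u i).2)%N
  end.
have [phi [phi_lt phi_g]] := common_nondecreasing_subsequence g (enum {: 'I_n + bool}).
exists (phi 0%N), (phi 1%N); split; first exact: phi_lt.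
have le_g x : (g (phi 0%N) x <= g (phi 1%N) x)%N by apply: phi_g; rewrite ?mem_enum.
apply/andP; split; last by apply/mnm_lepP => l; apply: le_g (inl l).
rewrite -val_eqE eqn_leq (le_g (inr true)) /=.
(* Truncated subtraction from [k] reverses the order here because indices are below [k]. *)
by have := le_g (inr false); rewrite /= leq_sub2lE // ltnW.
Qed.

Lemma not_Acc_descent (T : Type) (R : T -> T -> Prop) (x : T) :
  ~ Acc R x -> exists u : nat -> T, forall i, R (u i.+1) (u i).
Proof.
move=> x_nacc; have step (y : {y | ~ Acc R y}) : {z : {y | ~ Acc R y} | R (sval z) (sval y)}.
  apply: constructive_indefinite_description; apply: NNPP => no_z.
  apply: (svalP y); constructor => z Rzy.
  by apply: NNPP => z_nacc; apply: no_z; exists (exist _ z z_nacc).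
pose u i := iter i (fun y => sval (step y)) (exist _ x x_nacc).
by exists (fun i => sval (u i)) => i; exact: (svalP (step (u i))).
Qed.

(** * Monomial orderings *)

Lemma dvd_monomial_le (n k : nat) (gt : rel (fmon n k)) (a b : fmon n k) :
  monomial_ordering gt -> global_ordering gt -> fmon_dvd a b ->
  b = a \/ gt b a.
Proof.
move=> gt_ord gt_glob; case: a b => [m i] [m' i'] /andP[/= /eqP <- /submK def_m'].
have [m0|m_neq0] := eqVneq (m' - m)%MM 0%MM.
  by left; rewrite -def_m' m0 add0m.
right; have := mo_mul gt_ord m (gt_glob _ i m_neq0).
by rewrite addm0 addmC def_m'.
Qed.

(** In an infinite descent some monomial would divide a later one by [dickson], and a multiple is
    never smaller. *)
Lemma global_ordering_wf (n k : nat) (gt : rel (fmon n k)) :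
  monomial_ordering gt -> global_ordering gt ->
  well_founded (fun a b => gt b a).
Proof.
move=> gt_ord gt_glob a; apply: NNPP => a_nacc.
have [u u_dec] := not_Acc_descent a_nacc.
have [i [j [lt_ij dvd_ij]]] := dickson u.
have gt_ij : gt (u i) (u j).
  by apply: (@homo_ltn _ u (fun a b => gt a b)) lt_ij => //; apply: mo_trans gt_ord.
have gt_irr := mo_irr gt_ord; have [eq_ij|gt_ji] := dvd_monomial_le gt_ord gt_glob dvd_ij.
  by rewrite eq_ij gt_irr in gt_ij.
by have := mo_trans gt_ord gt_ij gt_ji; rewrite gt_irr.
Qed.

(** * Coefficients and leading monomials of vectors of polynomials *)

(** These additive functionals separate vectors ([fcoeffP]), so identities in the free module are
    checked one monomial at a time. *)
Definition fcoeff (K : fieldType) (n k : nat) (a : fmon n k)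
    (v : 'rV[{mpoly K[n]}]_k) : K :=
  (v 0 a.2)@_(a.1).

Section Coefficients.
Variables (K : fieldType) (n k : nat).
Implicit Types (a b : fmon n k) (t : fterm K n k) (v w : 'rV[{mpoly K[n]}]_k).

Lemma fcoeff_is_zmod_morphism a : zmod_morphism (@fcoeff K n k a).
Proof. by move=> v w; rewrite /fcoeff !mxE mcoeffB. Qed.

HB.instance Definition _ a :=
  GRing.isZmodMorphism.Build 'rV[{mpoly K[n]}]_k K (fcoeff a)
    (fcoeff_is_zmod_morphism a).

Lemma fcoeffB a v w : fcoeff a (v - w) = fcoeff a v - fcoeff a w.
Proof. exact: raddfB. Qed.

Lemma fcoeff_sum a (I : Type) (l : seq I) (P : pred I) (F : I -> 'rV[{mpoly K[n]}]_k) :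
  fcoeff a (\sum_(i <- l | P i) F i) = \sum_(i <- l | P i) fcoeff a (F i).
Proof. exact: raddf_sum. Qed.

Lemma fcoeff_sum_neq0 a (I : eqType) (l : seq I) (F : I -> 'rV[{mpoly K[n]}]_k) :
  fcoeff a (\sum_(i <- l) F i) != 0 -> exists2 i, i \in l & fcoeff a (F i) != 0.
Proof.
move=> sum_neq0; apply/hasP; apply: contraNT sum_neq0 => /hasPn F0.
by rewrite fcoeff_sum big_seq big1 // => i /F0; rewrite negbK => /eqP.
Qed.

Lemma fcoeffP v w : (forall a, fcoeff a v = fcoeff a w) -> v = w.
Proof.
move=> eq_vw; apply/rowP => i; apply/mpolyP => m; exact: (eq_vw (m, i)).
Qed.

Lemma fcoeff_term t a : fcoeff a (fterm_val t) = t.1 * (t.2 == a)%:R.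
Proof.
case: t a => [c [m i]] [m' i']; rewrite /fcoeff /fterm_val !mxE /= xpair_eqE eq_sym.
have [_|_] /= := eqVneq i i'; last by rewrite mulr0 mcoeff0 andbF mulr0.
by rewrite mulr1 mcoeffZ mcoeffX andbT.
Qed.

Lemma fcoeff_monomialM c m v a :
  fcoeff ((m + a.1)%MM, a.2) ((c *: 'X_[m]) *: v) = c * fcoeff a v.
Proof.
by rewrite /fcoeff mxE -scalerAl mcoeffZ ['X_[m] * _]mulrC mcoeffMX.
Qed.

Lemma fcoeffM_neq0 p v a :
  fcoeff a (p *: v) != 0 ->
  exists m b, a = ((m + b.1)%MM, b.2) /\ fcoeff b v != 0.
Proof.
rewrite /fcoeff mxE -mcoeff_msupp => /msuppM_le/allpairsP[[m m'] /= [_ m'_v def_a]].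
by exists m, (m', a.2); rewrite -mcoeff_msupp -def_a -surjective_pairing.
Qed.

Lemma fcoeff_monomialM_neq0 c m v a :
  fcoeff a ((c *: 'X_[m]) *: v) != 0 ->
  exists2 b, a = ((m + b.1)%MM, b.2) & fcoeff b v != 0.
Proof.
rewrite /fcoeff mxE -scalerAl mcoeffZ mulf_eq0 negb_or mulrC => /andP[_].
rewrite -mcoeff_msupp (perm_mem (msuppMX _ _)) => /mapP[m' m'_v def_a].
by exists (m', a.2); rewrite -?mcoeff_msupp // -def_a -surjective_pairing.
Qed.

Lemma mem_fsupp v a : (a \in fsupp v) = (fcoeff a v != 0).
Proof.
rewrite -mcoeff_msupp; apply/allpairsPdep/idP => [[i [m [_ m_v ->]]] //|a_v].
by exists a.2, a.1; rewrite mem_enum -surjective_pairing.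
Qed.

Lemma fsupp_uniq v : uniq (fsupp v).
Proof.
apply: allpairs_uniq_dep => [|i _|]; rewrite ?enum_uniq ?msupp_uniq //.
by move=> [i m] [i' m'] _ _ [-> ->].
Qed.

Lemma mem_fterms v t : (t \in fterms v) = (t.1 != 0) && (t.1 == fcoeff t.2 v).
Proof.
apply/mapP/andP => [[a a_v ->]|[t_neq0 /eqP def_t]] /=.
  by rewrite -[_@__]/(fcoeff a v) -mem_fsupp a_v eqxx.
by exists t.2; rewrite ?mem_fsupp -?def_t // -[_@__]/(fcoeff t.2 v) -def_t -surjective_pairing.
Qed.

(** The filter [P] lets one statement serve both [LOT] and the full expansion [sum_fterms]. *)
Lemma fcoeff_sum_fterms v (P : pred (fmon n k)) a :
  fcoeff a (\sum_(t <- fterms v | P t.2) fterm_val t) =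
    if P a then fcoeff a v else 0.
Proof.
rewrite raddf_sum big_map big_mkcond /=.
under eq_bigr => b _ do rewrite fcoeff_term /= -[_@__]/(fcoeff b v).
have [a_v|] := boolP (a \in fsupp v).
  rewrite (bigD1_seq a) ?fsupp_uniq //= eqxx mulr1 big1 ?addr0 // => b /negPf->.
  by rewrite mulr0 if_same.
rewrite mem_fsupp negbK => /eqP a_v; rewrite a_v if_same big1 // => b _.
by case: eqVneq => [->|_]; rewrite ?a_v ?mul0r ?mulr0 if_same.
Qed.

Lemma sum_fterms v : \sum_(t <- fterms v) fterm_val t = v.
Proof. by apply: fcoeffP => a; rewrite (fcoeff_sum_fterms v predT). Qed.

Lemma fterm_val_inj t u : t.1 != 0 -> fterm_val t = fterm_val u -> t = u.
Proof.
case: t u => [c a] [d b] /= c_neq0 eq_tu.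
have := congr1 (fcoeff a) eq_tu; rewrite !fcoeff_term /= eqxx mulr1.
case: eqVneq => [->|_]; first by rewrite mulr1 => ->.
by rewrite mulr0 => c0; rewrite c0 eqxx in c_neq0.
Qed.

Lemma monomialM_fterm_val c m t :
  (c *: 'X_[m]) *: fterm_val t = fterm_val (c * t.1, ((m + t.2.1)%MM, t.2.2)).
Proof.
by rewrite /fterm_val /= scalerA -scalerAl -scalerAr scalerA mpolyXD.
Qed.

(** * Leading monomials from the order laws alone, for [gt] and for the induced ordering *)

Section LeadingMonomial.
Variable gt : rel (fmon n k).
Hypotheses (gt_irr : irreflexive gt) (gt_trans : transitive gt)
  (gt_total : forall a b, a != b -> gt a b || gt b a).

Let is_max (s : seq (fmon n k)) a := all (fun b => (b == a) || gt a b) s.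

Lemma max_unique (s : seq (fmon n k)) a b :
  a \in s -> b \in s -> is_max s a -> is_max s b -> a = b.
Proof.
move=> a_s b_s /allP/(_ b b_s)/predU1P[//|gt_ab] /allP/(_ a a_s)/predU1P[//|gt_ba].
by have := gt_trans gt_ab gt_ba; rewrite gt_irr.
Qed.

Lemma LM_Some v a :
  fcoeff a v != 0 -> (forall b, fcoeff b v != 0 -> b = a \/ gt a b) ->
  LM gt v = Some a.
Proof.
rewrite -mem_fsupp => a_v max_a; have {}max_a : is_max (fsupp v) a.
  by apply/allP => b; rewrite mem_fsupp => /max_a[->|->]; rewrite ?eqxx ?orbT.
rewrite /LM; have : a \in [seq a <- fsupp v | is_max (fsupp v) a].
  by rewrite mem_filter max_a.
case def_s: [seq _ <- _ | _] => [//|b s] _ /=.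
have : b \in [seq a <- fsupp v | is_max (fsupp v) a] by rewrite def_s mem_head.
by rewrite mem_filter => /andP[max_b b_v]; congr Some; apply: max_unique max_b max_a.
Qed.

Lemma LM_fcoeff_neq0 v a : LM gt v = Some a -> fcoeff a v != 0.
Proof.
rewrite /LM -mem_fsupp.
case def_s: [seq _ <- _ | _] => [//|b s] [<-].
have := mem_head b s; rewrite -def_s mem_filter => /andP[_]; exact.
Qed.

Lemma LM_max v a b : LM gt v = Some a -> fcoeff b v != 0 -> b = a \/ gt a b.
Proof.
rewrite /LM -mem_fsupp.
case def_s: [seq _ <- _ | _] => [//|c s] [<-] b_v.
have := mem_head c s; rewrite -def_s mem_filter => /andP[/allP/(_ b b_v)/predU1P[]] *; auto.
Qed.

Lemma max_exists (s : seq (fmon n k)) :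
  s != [::] -> exists2 a, a \in s & is_max s a.
Proof.
elim: s => // a [_ _|b s IHs _].
  by exists a; rewrite /is_max ?mem_head //= eqxx.
have [//|c c_s max_c] := IHs; have [eq_ac|/gt_total/orP[gt_ac|gt_ca]] := eqVneq a c.
- by exists c; [rewrite in_cons c_s orbT | apply/andP; rewrite eq_ac eqxx].
- exists a; rewrite ?mem_head // /is_max; apply/allP => d.
  rewrite in_cons => /predU1P[->|d_s]; first by rewrite eqxx.
  have /predU1P[->|gt_cd] := allP max_c d d_s; rewrite ?gt_ac ?orbT //.
  by rewrite (gt_trans gt_ac gt_cd) orbT.
- by exists c; [rewrite in_cons c_s orbT | apply/andP; rewrite gt_ca orbT].
Qed.

Lemma LM_exists v : v != 0 -> {a | LM gt v = Some a}.
Proof.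
case def_a: (LM gt v) => [a|] v_neq0; [by exists a | exfalso].
have [|a a_v max_a] := @max_exists (fsupp v).
  apply: contraNneq v_neq0 => v_nil; apply/eqP/fcoeffP => a; apply/eqP.
  by rewrite raddf0 -[_ == _]negbK -mem_fsupp v_nil.
move: def_a; rewrite /LM; have : a \in [seq a <- fsupp v | is_max (fsupp v) a].
  by rewrite mem_filter max_a.
by rewrite /is_max; case: [seq _ <- _ | _].
Qed.

End LeadingMonomial.

(** A monomial occurring in a combination of monomials is a multiple of one of them. This turns
    membership in a leading module into divisibility, for syzygies as well as for the Groebner
    basis. *)
Lemma leading_module_support (gt : rel (fmon n k)) (S : 'rV[{mpoly K[n]}]_k -> Prop) v a :
  leading_module gt S v -> fcoeff a v != 0 ->
  exists w b m, [/\ S w, LM gt w = Some b & a = ((m + b.1)%MM, b.2)].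
Proof.
case=> N [p [u [u_lead ->]]] /fcoeff_sum_neq0[j _ /fcoeffM_neq0[m [b [-> ]]]].
have [w [c [Sw _ LM_w ->]]] := u_lead j.
rewrite fcoeff_term mul1r; case: (eqVneq c b) => [<- _|]; last by rewrite eqxx.
by exists w, c, m.
Qed.

End Coefficients.

(** * The map [psi], as multiplication by the matrix with rows f_i *)

Lemma psi_mulmx (K : fieldType) (n s r : nat)
    (f : 'I_r -> 'rV[{mpoly K[n]}]_s) v :
  psi f v = v *m \matrix_i f i.
Proof. by rewrite mulmx_sum_row; apply: eq_bigr => i _; rewrite rowK. Qed.

Lemma psi_is_zmod_morphism (K : fieldType) (n s r : nat)
    (f : 'I_r -> 'rV[{mpoly K[n]}]_s) :
  zmod_morphism (psi f).
Proof. by move=> v w; rewrite !psi_mulmx mulmxBl. Qed.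

HB.instance Definition _ (K : fieldType) (n s r : nat)
    (f : 'I_r -> 'rV[{mpoly K[n]}]_s) :=
  GRing.isZmodMorphism.Build 'rV[{mpoly K[n]}]_r 'rV[{mpoly K[n]}]_s (psi f)
    (psi_is_zmod_morphism f).

Lemma psiB (K : fieldType) (n s r : nat)
    (f : 'I_r -> 'rV[{mpoly K[n]}]_s) v w :
  psi f (v - w) = psi f v - psi f w.
Proof. exact: raddfB. Qed.

Lemma psi_sum (K : fieldType) (n s r : nat)
    (f : 'I_r -> 'rV[{mpoly K[n]}]_s) (I : Type) (l : seq I) v :
  psi f (\sum_(i <- l) v i) = \sum_(i <- l) psi f (v i).
Proof. exact: raddf_sum. Qed.

Lemma psi_term (K : fieldType) (n s r : nat)
    (f : 'I_r -> 'rV[{mpoly K[n]}]_s) (t : fterm K n r) :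
  psi f (fterm_val t) = (t.1 *: 'X_[t.2.1]) *: f t.2.2.
Proof.
by rewrite psi_mulmx /fterm_val -scalemxAl -rowE rowK.
Qed.

Lemma psi_gen (K : fieldType) (n s r : nat)
    (f : 'I_r -> 'rV[{mpoly K[n]}]_s) v :
  submodule_gen (family_set f) (psi f v).
Proof. by exists r, (v 0), f; split=> // i; exists i. Qed.

(** * Liftings of leading syzygy terms *)

Section Lifting.
Variables (K : fieldType) (n s r : nat) (gt : rel (fmon n s)).
Variables (f : 'I_r -> 'rV[{mpoly K[n]}]_s) (L : 'I_r -> fmon n s).
Hypotheses (gt_ord : monomial_ordering gt) (gt_glob : global_ordering gt).
Hypothesis LM_f : forall i, LM gt (f i) = Some (L i).
Implicit Types (a b : fmon n r) (tau sigma u : fterm K n r)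
  (t : fterm K n s) (c : fmon n s).

Let gt_irr := mo_irr gt_ord.
Let gt_trans := mo_trans gt_ord.

(** The leading monomial of the image of [a] under [psi] ([LM_psi_term]); it is also the termination
    measure. *)
Definition psi_lm a : fmon n s := ((a.1 + (L a.2).1)%MM, (L a.2).2).

Definition lead_divisible c : bool := [exists i, fmon_dvd (L i) c].

Let lc i := fcoeff (L i) (f i).

Lemma lc_neq0 i : lc i != 0.
Proof. exact: LM_fcoeff_neq0 (LM_f i). Qed.

Lemma psi_lm_mul m a : psi_lm ((m + a.1)%MM, a.2) = ((m + (psi_lm a).1)%MM, (psi_lm a).2).
Proof. by rewrite /psi_lm /= addmA. Qed.

Lemma fcoeff_psi_lm tau : fcoeff (psi_lm tau.2) (psi f (fterm_val tau)) = tau.1 * lc tau.2.2.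
Proof. by rewrite psi_term fcoeff_monomialM. Qed.

Lemma psi_term_support tau c :
  fcoeff c (psi f (fterm_val tau)) != 0 -> c = psi_lm tau.2 \/ gt (psi_lm tau.2) c.
Proof.
rewrite psi_term => /fcoeff_monomialM_neq0[b -> /(LM_max (LM_f _))[->|]]; first by left.
rewrite {1}[L _]surjective_pairing {1}[b]surjective_pairing.
by move=> /(mo_mul gt_ord tau.2.1); right.
Qed.

Lemma LM_psi_term tau : tau.1 != 0 -> LM gt (psi f (fterm_val tau)) = Some (psi_lm tau.2).
Proof.
move=> tau_neq0; apply: LM_Some => //; last exact: psi_term_support.
by rewrite fcoeff_psi_lm mulf_neq0 ?lc_neq0.
Qed.

Lemma LTval_psi_term tau : tau.1 != 0 ->
  LTval gt (psi f (fterm_val tau)) = fterm_val (tau.1 * lc tau.2.2, psi_lm tau.2).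
Proof.
by move=> tau_neq0; rewrite /LTval /LT LM_psi_term //= -fcoeff_psi_lm.
Qed.

Lemma subtree_choiceE t u : t.1 != 0 ->
  subtree_choice gt f t u <-> t = (u.1 * lc u.2.2, psi_lm u.2).
Proof.
move=> t_neq0; rewrite /subtree_choice /LTval /LT LM_f monomialM_fterm_val.
split=> [eq_t|->] //; exact: (fterm_val_inj t_neq0 (esym eq_t)).
Qed.

Lemma induced_orderingE a b :
  induced_ordering gt f a b =
    gt (psi_lm a) (psi_lm b) || (psi_lm a == psi_lm b) && (b.2 < a.2)%N.
Proof.
have LM_X d : LM gt ('X_[d.1] *: f d.2) = Some (psi_lm d).
  by rewrite -(@LM_psi_term (1, d)) ?oner_neq0 // psi_term scale1r.
by rewrite /induced_ordering !LM_X.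
Qed.

Lemma induced_irr : irreflexive (induced_ordering gt f).
Proof. by move=> a; rewrite induced_orderingE gt_irr ltnn andbF. Qed.

Lemma induced_trans : transitive (induced_ordering gt f).
Proof.
move=> b a c; rewrite !induced_orderingE.
case/orP=> [gt_ab|/andP[/eqP-> lt_ba]] /orP[gt_bc|/andP[/eqP<- lt_cb]].
- by rewrite (gt_trans gt_ab gt_bc).
- by rewrite gt_ab.
- by rewrite gt_bc.
- by rewrite eqxx (ltn_trans lt_cb lt_ba) orbT.
Qed.

Lemma fcoeff_sub_LOT (g : 'rV[{mpoly K[n]}]_s) c :
  fcoeff c (g - LOT gt f g) = if lead_divisible c then fcoeff c g else 0.
Proof.
have -> : LOT gt f g = \sum_(t <- fterms g | predC lead_divisible t.2) fterm_val t.
  apply: eq_bigl => t; rewrite /lower_order /= negb_exists.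
  by apply: eq_forallb => i; rewrite LM_f.
rewrite fcoeffB (fcoeff_sum_fterms g (predC lead_divisible)) /=.
by case: lead_divisible; rewrite ?subr0 ?subrr.
Qed.

Lemma mem_tree_terms sigma t :
  (t \in tree_terms gt f sigma) =
    [&& t.1 != 0, lead_divisible t.2 & t.1 == fcoeff t.2 (psi f (fterm_val sigma))].
Proof.
rewrite /tree_terms mem_fterms fcoeff_sub_LOT.
by case: lead_divisible => //; case: eqP.
Qed.

Lemma mem_subtree_terms tau t : tau.1 != 0 ->
  (t \in subtree_terms gt f tau) =
    [&& t.1 != 0, lead_divisible t.2, t.2 != psi_lm tau.2
      & t.1 == fcoeff t.2 (psi f (fterm_val tau))].
Proof.
move=> tau_neq0; rewrite /subtree_terms mem_fterms fcoeff_sub_LOT fcoeffB.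
rewrite LTval_psi_term // fcoeff_term /=.
case: lead_divisible; last by case: eqP.
rewrite [t.2 == _]eq_sym; have [<-|_] := eqVneq (psi_lm tau.2) t.2; last by rewrite mulr0 subr0.
by rewrite fcoeff_psi_lm mulr1 subrr; case: eqP.
Qed.

(** The type of terms admits a zero coefficient; this case lets [subtree_termsP] hold for every
    [tau]. *)
Lemma subtree_terms0 tau : tau.1 = 0 -> subtree_terms gt f tau = [::].
Proof.
move=> tau0; case def_s: subtree_terms => [//|t l].
have: t \in subtree_terms gt f tau by rewrite def_s mem_head.
rewrite /subtree_terms psi_term tau0 scale0r scale0r mem_fterms fcoeff_sub_LOT.
have -> : LTval gt (0 : 'rV[{mpoly K[n]}]_s) = 0.
  rewrite /LTval /LT; case def_a: LM => [a|//].
  by have := LM_fcoeff_neq0 def_a; rewrite raddf0 eqxx.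
by rewrite subr0 raddf0 if_same => /andP[/negPf->].
Qed.

Lemma subtree_termsP tau t :
  t \in subtree_terms gt f tau ->
  [/\ tau.1 != 0, t.1 != 0, lead_divisible t.2 & gt (psi_lm tau.2) t.2].
Proof.
have [/subtree_terms0->//|tau_neq0] := eqVneq tau.1 0.
rewrite mem_subtree_terms // => /and4P[t_neq0 t_div t_neq /eqP def_t].
split=> //; have := t_neq0; rewrite def_t => /psi_term_support[] // eq_t.
by rewrite eq_t eqxx in t_neq.
Qed.

Lemma subtree_choice_exists t :
  t.1 != 0 -> lead_divisible t.2 -> exists u, subtree_choice gt f t u.
Proof.
move=> t_neq0 /existsP[i /andP[/eqP eq_i /submK def_m]].
exists (t.1 / lc i, ((t.2.1 - (L i).1)%MM, i)); apply/subtree_choiceE => //=.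
rewrite divfK ?lc_neq0 // /psi_lm /= def_m eq_i.
by case: (t) => c [].
Qed.

Lemma subtree_choiceP t u :
  t.1 != 0 -> subtree_choice gt f t u ->
  [/\ u.1 != 0, psi_lm u.2 = t.2 & LTval gt (psi f (fterm_val u)) = fterm_val t].
Proof.
move=> t_neq0 /(subtree_choiceE _ t_neq0) def_t.
have u_neq0 : u.1 != 0.
  by apply: contraNneq t_neq0 => u0; rewrite def_t /= u0 mul0r.
by rewrite LTval_psi_term // -def_t; split=> //; rewrite def_t.
Qed.

(** * Termination and invariants of [LiftSubtree] *)

Lemma subtree_call_Acc tau :
  Acc (fun callee caller => subtree_call gt f caller callee) tau.
Proof.
have [c def_c] : exists c, c = psi_lm tau.2 by exists (psi_lm tau.2).
elim: {c}(global_ordering_wf gt_ord gt_glob c) tau def_c => c _ IHc tau def_c.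
constructor=> u [t /subtree_termsP[_ t_neq0 _ gt_t] /(subtree_choiceP t_neq0)[_ lm_u _]].
by apply: (IHc t.2); rewrite ?def_c ?lm_u.
Qed.

(** Each callee has a strictly smaller leading image than its caller, hence is smaller in the
    induced ordering whatever its index. *)
Lemma LiftSubtree_support tau w a :
  LiftSubtree gt f tau w -> fcoeff a w != 0 ->
  a = tau.2 \/ induced_ordering gt f tau.2 a.
Proof.
move=> run; elim: run a => {w}tau ch res ch_ok _ IHres a.
rewrite fcoeffB fcoeff_term.
have [->|neq_a] := eqVneq tau.2 a; first by left.
rewrite mulr0 sub0r oppr_eq0 => /fcoeff_sum_neq0[t t_in res_t]; right.
have [_ t_neq0 _ gt_t] := subtree_termsP t_in.
have [_ lm_t _] := subtree_choiceP t_neq0 (ch_ok t t_in).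
have gt_ch : induced_ordering gt f tau.2 (ch t).2.
  by rewrite induced_orderingE lm_t gt_t.
have [-> //|] := IHres t t_in a res_t.
exact: induced_trans.
Qed.

(* Modulo lower order terms, psi maps the returned value to LT(psi(tau)):     *)
(* the recursive calls kill every other term.                                 *)
Lemma LiftSubtree_psi tau w c :
  LiftSubtree gt f tau w -> tau.1 != 0 -> lead_divisible c ->
  fcoeff c (psi f w) = fcoeff c (LTval gt (psi f (fterm_val tau))).
Proof.
move=> run; elim: run => {w}tau ch res ch_ok _ IHres tau_neq0 c_div.
rewrite psiB psi_sum fcoeffB fcoeff_sum (eq_big_seq (fun t => fcoeff c (fterm_val t))).
  (* With h = psi(tau), this is h - (h - LT(h)) = LT(h) at the monomial [c]. *)
  by rewrite -fcoeff_sum sum_fterms fcoeff_sub_LOT c_div fcoeffB subKr.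
move=> t t_in; have [_ t_neq0 _ _] := subtree_termsP t_in.
have [ch_neq0 _ <-] := subtree_choiceP t_neq0 (ch_ok t t_in).
exact: IHres.
Qed.

(** * Choices and invariants of [LiftTree] *)

Section Tree.
Variable sigma : fterm K n r.
Hypothesis sigma_neq0 : sigma.1 != 0.

Lemma tree_termsP t :
  t \in tree_terms gt f sigma ->
  [/\ t.1 != 0, lead_divisible t.2 & t.2 = psi_lm sigma.2 \/ gt (psi_lm sigma.2) t.2].
Proof.
rewrite mem_tree_terms => /and3P[t_neq0 t_div /eqP def_t]; split=> //.
by apply: psi_term_support; rewrite -def_t.
Qed.

(* In a syzygy, the image of the leading term must cancel against another     *)
(* term of the same order, whose index is then smaller.                       *)
(* The image of the leading monomial a must cancel against that of another    *)
(* monomial of v, which has a smaller index because the tie is won by a.      *)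
Lemma leading_syzygy_cancel v a :
  Syz f v -> LM (induced_ordering gt f) v = Some a ->
  exists2 b, psi_lm b = psi_lm a & (b.2 < a.2)%N.
Proof.
move=> v_syz LM_v.
have [/hasP[b b_v /andP[/eqP eq_b lt_b]]|/hasPn no_b] :=
  boolP (has (fun b => (psi_lm b == psi_lm a) && (b.2 < a.2)%N) (fsupp v)).
  by exists b.
have := congr1 (fcoeff (psi_lm a)) v_syz; rewrite raddf0 -[v]sum_fterms psi_sum fcoeff_sum.
have a_v := LM_fcoeff_neq0 LM_v.
rewrite big_map (bigD1_seq a) ?fsupp_uniq ?mem_fsupp //= big_seq_cond big1.
  rewrite addr0 (fcoeff_psi_lm (fcoeff a v, a)) => /eqP; rewrite mulf_eq0 (negPf (lc_neq0 _)) orbF.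
  by rewrite -[_ == 0]negbK a_v.
(* If another [b] contributed at [psi_lm a], then [psi_lm b] would be at least [psi_lm a]; as [a] is
   leading, they would be equal and [b] would have the smaller index, against [no_b]. *)
move=> b /andP[b_v neq_ba]; apply/eqP; apply/negPn/negP => /psi_term_support /= ba.
have := no_b b b_v; move: b_v; rewrite mem_fsupp => /(LM_max LM_v)[/eqP|].
  by rewrite (negPf neq_ba).
rewrite induced_orderingE => /orP[gt_ab _|/andP[/eqP-> ->]]; last by rewrite eqxx.
case: ba => [eq_ab|gt_ba]; first by rewrite eq_ab gt_irr in gt_ab.
by have := gt_trans gt_ab gt_ba; rewrite gt_irr.
Qed.

(** The monomial of sigma is a multiple of the leading monomial of some syzygy; multiplying the
    monomial that cancels there by the same factor keeps its index. *)
Lemma leading_term_cancel :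
  leading_module (induced_ordering gt f) (Syz f) (fterm_val sigma) ->
  exists2 b, psi_lm b = psi_lm sigma.2 & (b.2 < sigma.2.2)%N.
Proof.
move=> sigma_lead; have coeff_neq0 : fcoeff sigma.2 (fterm_val sigma) != 0.
  by rewrite fcoeff_term eqxx mulr1.
have [v [a [m [v_syz LM_v ->]]]] := leading_module_support sigma_lead coeff_neq0.
have [c eq_c lt_c] := leading_syzygy_cancel v_syz LM_v.
by exists ((m + c.1)%MM, c.2); rewrite // !psi_lm_mul eq_c.
Qed.

Hypothesis sigma_lead :
  leading_module (induced_ordering gt f) (Syz f) (fterm_val sigma).

(** Below the leading image of sigma every admissible choice is automatically smaller than sigma. At
    the leading image itself, the smaller index from [leading_term_cancel] decides the tie. *)
Lemma tree_choice_exists t :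
  t \in tree_terms gt f sigma -> exists u, tree_choice gt f sigma t u.
Proof.
case/tree_termsP=> t_neq0 t_div [def_t|gt_t]; last first.
  have [u u_ok] := subtree_choice_exists t_neq0 t_div; exists u; split=> //.
  by have [_ lm_u _] := subtree_choiceP t_neq0 u_ok; rewrite induced_orderingE lm_u gt_t.
have [b eq_b lt_b] := leading_term_cancel sigma_lead.
exists (t.1 / lc b.2, b); split.
  apply/subtree_choiceE => //=; rewrite divfK ?lc_neq0 // eq_b -def_t.
  exact: surjective_pairing.
by rewrite induced_orderingE eq_b eqxx lt_b orbT.
Qed.

(** The choices of [LiftTree] are required to be smaller than sigma, and the subtrees stay at or
    below them, so nothing subtracted touches sigma. *)
Lemma LiftTree_LT v :
  LiftTree gt f sigma v -> LT (induced_ordering gt f) v = Some sigma.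
Proof.
case=> ch res ch_ok res_ok.
set w := \sum_(t <- _) _.
have w_lt a : fcoeff a w != 0 -> induced_ordering gt f sigma.2 a.
  move=> /fcoeff_sum_neq0[t t_in res_t].
  have [_ gt_ch] := ch_ok t t_in.
  have [-> //|] := LiftSubtree_support (res_ok t t_in) res_t.
  exact: induced_trans.
have coeff_sigma : fcoeff sigma.2 (fterm_val sigma - w) = sigma.1.
  rewrite fcoeffB fcoeff_term eqxx mulr1.
  have [->|/w_lt] := eqVneq (fcoeff sigma.2 w) 0; first by rewrite subr0.
  by rewrite induced_irr.
have LM_sigma : LM (induced_ordering gt f) (fterm_val sigma - w) = Some sigma.2.
  apply: LM_Some; [exact: induced_irr | exact: induced_trans | by rewrite coeff_sigma |].
  move=> b; rewrite fcoeffB fcoeff_term; have [->|_] := eqVneq sigma.2 b; first by left.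
  by rewrite mulr0 sub0r oppr_eq0 => /w_lt; right.
rewrite /LT LM_sigma /= -[_@__]/(fcoeff sigma.2 _) coeff_sigma.
by rewrite -surjective_pairing.
Qed.

(** The terms treated here include the leading term of psi(sigma), so no leading term is left over,
    unlike in [LiftSubtree_psi]. *)
Lemma LiftTree_psi v c :
  LiftTree gt f sigma v -> lead_divisible c -> fcoeff c (psi f v) = 0.
Proof.
case=> ch res ch_ok res_ok c_div.
rewrite psiB psi_sum fcoeffB fcoeff_sum (eq_big_seq (fun t => fcoeff c (fterm_val t))).
  by rewrite -fcoeff_sum sum_fterms fcoeff_sub_LOT c_div subrr.
move=> t t_in; have [t_neq0 _ _] := tree_termsP t_in.
have [ch_neq0 _ <-] := subtree_choiceP t_neq0 (ch_ok t t_in).1.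
exact: (LiftSubtree_psi (res_ok t t_in)).
Qed.

End Tree.

Lemma groebner_lead_divisible v c :
  groebner_basis gt f -> LM gt (psi f v) = Some c -> lead_divisible c.
Proof.
move=> f_gb LM_v.
have c_lead : leading_module gt (submodule_gen (family_set f)) (fterm_val (1, c)).
  exists 1%N, (fun=> 1), (fun=> fterm_val (1, c)).
  split=> [_|]; last by rewrite big_ord1 scale1r.
  exists (psi f v), c; split=> //; first exact: psi_gen.
  by apply: contraTneq (LM_fcoeff_neq0 LM_v) => ->; rewrite raddf0 eqxx.
have coeff_neq0 : fcoeff c (fterm_val (1, c)) != 0 :> K.
  by rewrite fcoeff_term eqxx mulr1 oner_neq0.
have [w [a [m [[i ->] LM_i ->]]]] :=
  leading_module_support ((f_gb _).2 c_lead) coeff_neq0.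
move: LM_i; rewrite LM_f => -[<-].
by apply/existsP; exists i; rewrite /fmon_dvd eqxx lem_addl.
Qed.

End Lifting.

Theorem mainTheorem2 (K : fieldType) (n s r : nat)
    (gt : rel (fmon n s)) (f : 'I_r -> 'rV[{mpoly K[n]}]_s)
    (sigma : fterm K n r)
    (gt_ord : monomial_ordering gt) (gt_glob : global_ordering gt)
    (f_neq0 : forall i, f i != 0) (f_gb : groebner_basis gt f)
    (sigma_neq0 : sigma.1 != 0)
    (sigma_lead :
       leading_module (induced_ordering gt f) (Syz f) (fterm_val sigma)) :
  [/\ choices_possible gt f sigma,
      terminates gt f sigma
    & forall v, LiftTree gt f sigma v -> lifting gt f sigma v].
Proof.
have LM_ex v := @LM_exists _ _ _ gt (mo_trans gt_ord) (mo_total gt_ord) v.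
pose L i := sval (LM_ex _ (f i) (f_neq0 i)).
have LM_f i : LM gt (f i) = Some (L i) := svalP (LM_ex _ (f i) (f_neq0 i)).
split.
- split=> [t|tau _ t]; first exact: (tree_choice_exists gt_ord LM_f sigma_neq0 sigma_lead).
  by case/(subtree_termsP gt_ord LM_f)=> _ t_neq0 t_div _;
     exact: (subtree_choice_exists LM_f t_neq0 t_div).
- by move=> u _; exact: (subtree_call_Acc gt_ord gt_glob LM_f u).
move=> v v_run; split; first exact: (LiftTree_LT gt_ord LM_f sigma_neq0).
(* A non-zero image would have a leading monomial divisible by some LM(f_i), where its coefficient
   vanishes. *)
apply/eqP; apply/negPn/negP => /LM_ex[c LM_c].
have := LM_fcoeff_neq0 LM_c.
by rewrite (LiftTree_psi gt_ord LM_f v_run) ?eqxx // (groebner_lead_divisible LM_f f_gb LM_c).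
Qed.
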